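(* For a real Hilbert space $X$ and a monotone linear operator $A:X\to X$ (with full domain $X$), let the code of $A$ be the binary string $p\,s\,c\,t$, where $p=1$ if $A$ is paramonotone and $p=0$ otherwise, $s=1$ if $A$ is strictly monotone and $s=0$ otherwise, $c=1$ if $A$ is $3$-cyclic monotone and $c=0$ otherwise, and $t=1$ if $A$ is $3^*$-monotone and $t=0$ otherwise. Then the set of codes that are attained by some monotone linear operator with full domain on some real Hilbert space is exactly $$\{0000,\ 1000,\ 1001,\ 1011,\ 1100,\ 1101,\ 1111\}.$$
   Context: A linear operator $A:X\to X$ on a real Hilbert space with inner product $\langle\cdot,\cdot\rangle$ is monotone if $\langle x-y,Ax-Ay\rangle\ge 0$ for all $x,y\in X$. For such an $A$ (single-valued, defined everywhere): - paramonotone: $A$ is monotone and $\langle x-y,Ax-Ay\rangle=0$ implies $Ax=Ay$; - strictly monotone: $A$ is monotone and $\langle x-y,Ax-Ay\rangle=0$ implies $x=y$; - $3$-cyclic monotone: $\langle x-y,Ax\rangle+\langle y-z,Ay\rangle+\langle z-x,Az\rangle\ge 0$ for all $x,y,z\in X$; - $3^*$-monotone: $A$ is monotone and for all $z,x\in X$ one has $\sup_{y\in X}\langle z-y,Ay-Ax\rangle<+\infty$. *)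

(* Defs.v *)
From HB Require Import structures.
From mathcomp Require Import all_boot all_order all_algebra.
From mathcomp Require Import all_classical all_reals all_analysis.

Set Implicit Arguments.
Unset Strict Implicit.
Unset Printing Implicit Defensive.

Import Order.TTheory GRing.Theory Num.Theory.
Import numFieldNormedType.Exports.

Local Open Scope classical_set_scope.
Local Open Scope ring_scope.

(* A real Hilbert space: a complete normed module whose norm comes from an
   inner product, i.e. from a symmetric (theta = idfun) positive definite
   bilinear form. *)
HB.mixin Record CompleteNormedModule_isHilbert (R : realType) X
    & CompleteNormedModule R X := {
  inner : {dot X for @idfun R};
  innerxx : forall x : X, inner x x = `|x| ^+ 2
}.

#[short(type="hilbertType")]
HB.structure Definition Hilbert (R : realType) :=
  {X of CompleteNormedModule R X & CompleteNormedModule_isHilbert R X}.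

Section operators.
Variables (R : realType) (X : hilbertType R).
Implicit Type A : X -> X.

Definition monotone_op A :=
  forall x y : X, 0 <= inner (x - y) (A x - A y).

Definition paramonotone_op A := monotone_op A /\
  forall x y : X, inner (x - y) (A x - A y) = 0 -> A x = A y.

Definition strictly_monotone_op A := monotone_op A /\
  forall x y : X, inner (x - y) (A x - A y) = 0 -> x = y.

Definition three_cyclic_monotone_op A := forall x y z : X,
  0 <= inner (x - y) (A x) + inner (y - z) (A y) + inner (z - x) (A z).

Definition three_star_monotone_op A := monotone_op A /\
  forall z x : X,
    (ereal_sup (range (fun y : X => (inner (z - y) (A y - A x))%:E)) < +oo)%E.

Definition monotonicity_code A : seq nat :=
  [:: nat_of_bool `[< paramonotone_op A >];
      nat_of_bool `[< strictly_monotone_op A >];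
      nat_of_bool `[< three_cyclic_monotone_op A >];
      nat_of_bool `[< three_star_monotone_op A >]].

End operators.

(* Main.v *)
Require Import Defs.
From HB Require Import structures.
From mathcomp Require Import all_boot all_order all_algebra.
From mathcomp Require Import all_classical all_reals all_analysis.
From mathcomp Require Import ring lra.

(** A linear operator [A] is tested on its quadratic form [q x = inner x (A x)]:
    monotone means [q >= 0], paramonotone that [q x = 0] forces [A x = 0],
    strictly monotone that [q x = 0] forces [x = 0].  At most seven codes occur,
    because strict monotonicity and 3-star monotonicity each imply
    paramonotonicity, and 3-cyclic monotonicity implies 3-star monotonicity
    ([strictly_monotone_paramonotone], [three_star_monotone_paramonotone],
    [three_cyclic_three_star_monotone]).

    All seven are attained by operators on one Hilbert space, the space [l2] of
    square summable sequences of points of the plane, of the form [block_op]: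
    on the n-th plane act by the matrix with rows (a n, - b n) and (b n, a n),
    that is, a n times the identity plus b n times the quarter turn.  The
    quarter turn does not contribute to the quadratic form, so that
    q x = sum of a n |x n|^2, and the properties can be read off from [a] and
    [b] when [a] is nonnegative:
    - paramonotone iff [b n = 0] wherever [a n = 0];
    - strictly monotone iff no [a n] vanishes;
    - 3-cyclic monotone if [b = 0], and not if [b n > 2 * a n] for some [n];
    - 3-star monotone if [a n ^+ 2 + b n ^+ 2 <= C * a n] for a constant [C],
      as then [A] is cocoercive, and not if [b n = 1] while [a n] tends to 0
      fast enough.
    The second half of the last item gives 1000 and 1100, where a paramonotone
    operator is not 3-star monotone: this is where infinite dimension matters.
    In these examples, replacing one block by 0 destroys strict monotonicity
    and leaves the rest of the code unchanged. *)

Set Implicit Arguments.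
Unset Strict Implicit.
Unset Printing Implicit Defensive.

Import Order.TTheory GRing.Theory Num.Theory.
Import numFieldNormedType.Exports.

Local Open Scope classical_set_scope.
Local Open Scope ring_scope.

(** * The space of square summable sequences in the plane *)

Section pairdot.
Variable R : realType.
Implicit Types u v w : R * R.

Definition pairdot u v : R := u.1 * v.1 + u.2 * v.2.

Lemma pairdotC u v : pairdot u v = pairdot v u.
Proof. by rewrite /pairdot; ring. Qed.

Lemma pairdotPl k u v w : pairdot (k *: u + v) w = k * pairdot u w + pairdot v w.
Proof.
rewrite /pairdot /=; have scaleE (x : R) : k *: x = k * x by [].
by rewrite !scaleE; ring.
Qed.

Lemma pairdot_ge0 u : 0 <= pairdot u u.
Proof. by rewrite /pairdot -!expr2 addr_ge0 ?sqr_ge0. Qed.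

Lemma pairdot_eq0 u : pairdot u u = 0 -> u = 0.
Proof.
case: u => x y; rewrite /pairdot /= -!expr2 => /eqP.
by rewrite paddr_eq0 ?sqr_ge0// !sqrf_eq0 => /andP[/eqP-> /eqP->].
Qed.

End pairdot.

Section l2_predicate.
Variable R : realType.
Implicit Types x y z : nat -> R * R.

(** Bounded partial sums rather than a convergent series: closure under linear
    combinations is then a termwise estimate. *)
Definition square_summable : {pred nat -> R * R} := fun x =>
  `[< exists M, forall n, \sum_(0 <= i < n) pairdot (x i) (x i) <= M >].

Lemma square_summableP x : reflect
  (exists M, forall n, \sum_(0 <= i < n) pairdot (x i) (x i) <= M)
  (x \in square_summable).
Proof. exact: asboolP. Qed.

Lemma square_summable_submod : submod_closed square_summable.
Proof.
split.
  apply/square_summableP; exists 0 => n; rewrite big1// => i _.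
  by rewrite /pairdot /= !mul0r addr0.
move=> k x y /square_summableP[M xM] /square_summableP[N yN].
apply/square_summableP; exists (2 * k ^+ 2 * M + 2 * N) => n.
apply: (@le_trans _ _ (\sum_(0 <= i < n)
  (2 * k ^+ 2 * pairdot (x i) (x i) + 2 * pairdot (y i) (y i)))).
  apply: ler_sum => i _; rewrite -subr_ge0.
  have -> : (k *: x + y) i = k *: x i + y i by [].
  (* parallelogram law: |kx + y|^2 + |kx - y|^2 = 2 |kx|^2 + 2 |y|^2 *)
  suff -> : 2 * k ^+ 2 * pairdot (x i) (x i) + 2 * pairdot (y i) (y i)
     - pairdot (k *: x i + y i) (k *: x i + y i) =
     pairdot (k *: x i - y i) (k *: x i - y i) by exact: pairdot_ge0.
  rewrite /pairdot /=; have scaleE (r : R) : k *: r = k * r by [].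
  by rewrite !scaleE; ring.
rewrite big_split /= -!mulr_sumr lerD// ler_wpM2l// mulr_ge0 ?sqr_ge0//.
Qed.

End l2_predicate.

HB.instance Definition _ (R : realType) :=
  GRing.isSubmodClosed.Build R (nat -> R * R)%type (@square_summable R)
    (@square_summable_submod R).

Record l2 (R : realType) := L2 {
  l2val :> nat -> R * R;
  l2valP : l2val \in @square_summable R }.

HB.instance Definition _ (R : realType) := [isSub for @l2val R].
HB.instance Definition _ (R : realType) := [Choice of l2 R by <:].
HB.instance Definition _ (R : realType) := [SubChoice_isSubLmodule of l2 R by <:].

Section l2_dot.
Variable R : realType.
Implicit Types x y z w : l2 R.

Lemma l2P x y : (forall n, x n = y n) -> x = y.
Proof. by move=> xy; apply/val_inj/funext. Qed.

Lemma l2Bl x y n : (x - y) n = x n - y n.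
Proof. by []. Qed.

Definition l2dot x y : R := limn (series (fun i => pairdot (x i) (y i))).

Lemma is_cvg_l2dotxx x : cvgn (series (fun i => pairdot (x i) (x i))).
Proof.
have /square_summableP[M xM] := l2valP x.
apply: nondecreasing_is_cvgn; last by exists M => _ [n _ <-]; exact: xM.
by apply: nondecreasing_series => n _ _; exact: pairdot_ge0.
Qed.

(** By polarization, since the series of squared norms converge. *)
Lemma is_cvg_l2dot x y : cvgn (series (fun i => pairdot (x i) (y i))).
Proof.
have -> : (fun i => pairdot (x i) (y i)) = 4^-1 *:
  ((fun i => pairdot ((x + y) i) ((x + y) i)) -
   (fun i => pairdot ((x - y) i) ((x - y) i)) : nat -> R).
  apply/funext => i; rewrite !fctE /pairdot /=.
  have scaleE (u v : R) : u *: v = u * v by [].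
  by rewrite scaleE; field.
by apply: is_cvg_seriesZ; apply: is_cvg_seriesB; exact: is_cvg_l2dotxx.
Qed.

Lemma l2dotC x y : l2dot x y = l2dot y x.
Proof.
by congr (limn (series _)); apply/funext => i; exact: pairdotC.
Qed.

Lemma l2dotPl k x y z : l2dot (k *: x + y) z = k * l2dot x z + l2dot y z.
Proof.
apply/cvg_lim => //.
have -> : series (fun i => pairdot ((k *: x + y) i) (z i)) =
  (fun n => k * series (fun i => pairdot (x i) (z i)) n +
            series (fun i => pairdot (y i) (z i)) n).
  apply/funext => n; rewrite /series /= mulr_sumr -big_split /=.
  by apply: eq_bigr => i _; exact: pairdotPl.
by apply: cvgD; [apply: cvgMl_tmp|]; exact: is_cvg_l2dot.
Qed.

Lemma l2dotPr k x y z : l2dot x (k *: y + z) = k * l2dot x y + l2dot x z.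
Proof. by rewrite !(l2dotC x) l2dotPl. Qed.

Lemma le_l2dot x y z w :
  (forall n, pairdot (x n) (y n) <= pairdot (z n) (w n)) ->
  l2dot x y <= l2dot z w.
Proof.
move=> le_pair; apply: ler_lim; [exact: is_cvg_l2dot..|].
by apply: nearW => n; apply: ler_sum => i _.
Qed.

Lemma pairdot_le_l2dot x y : (forall n, 0 <= pairdot (x n) (y n)) ->
  forall n, \sum_(0 <= i < n) pairdot (x i) (y i) <= l2dot x y.
Proof.
move=> xy0 n; apply: (@nondecreasing_cvgn_le _ (series _)).
  by apply: nondecreasing_series => i _ _.
exact: is_cvg_l2dot.
Qed.

Lemma l2dot_eq0 x y : (forall n, 0 <= pairdot (x n) (y n)) ->
  l2dot x y = 0 -> forall n, pairdot (x n) (y n) = 0.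
Proof.
move=> xy0 dot0 n; apply/eqP; rewrite eq_le xy0 andbT.
apply: le_trans (_ : \sum_(0 <= i < n.+1) pairdot (x i) (y i) <= 0).
  by rewrite big_nat_recr//= lerDr sumr_ge0.
by have := pairdot_le_l2dot xy0 n.+1; rewrite dot0.
Qed.

Lemma l2dot_ge0 x y : (forall n, 0 <= pairdot (x n) (y n)) -> 0 <= l2dot x y.
Proof.
by move=> xy0; have := pairdot_le_l2dot xy0 0; rewrite big_nil.
Qed.

Lemma l2dotxx_ge0 x : 0 <= l2dot x x.
Proof. by apply: l2dot_ge0 => n; exact: pairdot_ge0. Qed.

Lemma l2dotxx_eq0 x : l2dot x x = 0 -> x = 0.
Proof.
move=> x0; apply: l2P => n; apply: pairdot_eq0.
by apply: (l2dot_eq0 _ x0) => m; exact: pairdot_ge0.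
Qed.

Lemma l2dotxx_gt0 x : x != 0 -> 0 < l2dot x x.
Proof.
move=> x0; rewrite lt_def l2dotxx_ge0 andbT.
exact: contra_neq (@l2dotxx_eq0 x) x0.
Qed.

End l2_dot.

(** [l2dot] is the inner product that the Hilbert structure asks for: a dot
    product, that is, a Hermitian bilinear form for the trivial conjugation. *)
Section l2_dot_form.
Variable R : realType.

Let l2dot_bilinear :
  bilinear_for (GRing.Scale.Law.clone _ _ *%R _)
   (GRing.Scale.Law.clone _ _ (idfun \; *%R) _) (@l2dot R).
Proof.
split=> [y k x z|x k y z]; first exact: l2dotPl.
exact: l2dotPr.
Qed.

HB.instance Definition _ :=
  @bilinear_isBilinear.Build R (l2 R) (l2 R) R _ _ (@l2dot R) l2dot_bilinear.

Let l2dot_hermitian (x y : l2 R) : l2dot x y = (-1) ^+ false * idfun (l2dot y x).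
Proof. by rewrite expr0 mul1r; exact: l2dotC. Qed.

HB.instance Definition _ :=
  @isHermitianSesquilinear.Build R (l2 R) false idfun (@l2dot R) l2dot_hermitian.

HB.instance Definition _ :=
  @isDotProduct.Build R (l2 R) (@l2dot R) (@l2dotxx_gt0 R).

End l2_dot_form.

Section l2_norm.
Variable R : realType.
Implicit Types x y z : l2 R.

Lemma l2dotDl x y z : l2dot (x + y) z = l2dot x z + l2dot y z.
Proof. by rewrite -{1}[x]scale1r l2dotPl mul1r. Qed.

Lemma l2dotZl k x z : l2dot (k *: x) z = k * l2dot x z.
Proof.
have l2dot0 : l2dot 0 z = 0.
  by have := l2dotDl 0 0 z; rewrite addr0 => /eqP; rewrite -subr_eq subrr => /eqP.
by rewrite -{1}[k *: x]addr0 l2dotPl l2dot0 addr0.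
Qed.

Definition l2norm x : R := Num.sqrt (l2dot x x).

Lemma sqr_l2norm x : l2norm x ^+ 2 = l2dot x x.
Proof. by rewrite sqr_sqrtr// l2dotxx_ge0. Qed.

Lemma l2norm_eq0 x : l2norm x = 0 -> x = 0.
Proof. by move=> x0; apply: l2dotxx_eq0; rewrite -sqr_l2norm x0 expr0n. Qed.

Lemma l2normZ k x : l2norm (k *: x) = `|k| * l2norm x.
Proof.
by rewrite /l2norm l2dotZl l2dotC l2dotZl mulrA -expr2 sqrtrM ?sqr_ge0// sqrtr_sqr.
Qed.

(** Cauchy-Schwarz, from [| |y| x - |x| y |^2 >= 0]. *)
Lemma l2dot_le_l2norm x y : l2dot x y <= l2norm x * l2norm y.
Proof.
have [/eqP/l2norm_eq0 ->|x0] := boolP (l2norm x == 0).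
  by rewrite -(scale0r 0) l2dotZl mul0r mulr_ge0 ?sqrtr_ge0.
have [/eqP/l2norm_eq0 ->|y0] := boolP (l2norm y == 0).
  by rewrite -(scale0r 0) l2dotC l2dotZl mul0r mulr_ge0 ?sqrtr_ge0.
have := l2dotxx_ge0 (l2norm y *: x + (- l2norm x) *: y).
rewrite l2dotDl !l2dotZl !(l2dotC _ (_ + _)) !l2dotDl !l2dotZl.
rewrite (l2dotC y x) -!sqr_l2norm => h.
have xy_gt0 : 0 < l2norm x * l2norm y.
  by rewrite mulr_gt0// lt_def ?x0 ?y0 sqrtr_ge0.
rewrite -(ler_pM2l xy_gt0) -subr_ge0; nra.
Qed.

Lemma ler_l2normD x y : l2norm (x + y) <= l2norm x + l2norm y.
Proof.
rewrite -(@ler_pXn2r _ 2)// ?nnegrE ?addr_ge0 ?sqrtr_ge0//.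
rewrite sqr_l2norm l2dotDl !(l2dotC _ (_ + _)) !l2dotDl (l2dotC y x).
rewrite sqrrD -!sqr_l2norm; have := l2dot_le_l2norm x y; lra.
Qed.

End l2_norm.

HB.instance Definition _ (R : realType) :=
  Lmodule_isNormed.Build R (l2 R) (@ler_l2normD R) (@l2normZ R) (@l2norm_eq0 R).

Section l2_complete.
Variable R : realType.
Implicit Types x y z : l2 R.

Lemma l2_normE x : `|x| = l2norm x.
Proof. by []. Qed.

Lemma pairdot_sum_le x n :
  \sum_(0 <= i < n) pairdot (x i) (x i) <= `|x| ^+ 2.
Proof.
by rewrite l2_normE sqr_l2norm; apply: pairdot_le_l2dot => i; exact: pairdot_ge0.
Qed.

Lemma coord_le_norm x n : `|(x n).1| <= `|x| /\ `|(x n).2| <= `|x|.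
Proof.
have xn : (x n).1 ^+ 2 + (x n).2 ^+ 2 <= `|x| ^+ 2.
  apply: le_trans (pairdot_sum_le x n.+1).
  rewrite big_nat_recr//= [X in _ <= _ + X]/pairdot -!expr2 lerDr.
  by apply: sumr_ge0 => i _; exact: pairdot_ge0.
have := sqr_ge0 (x n).1; have := sqr_ge0 (x n).2.
by split; rewrite -(@ler_pXn2r _ 2)// ?nnegrE// real_normK ?num_real//; lra.
Qed.

(** Both coordinates of every entry are 1-Lipschitz, so they converge along a
    Cauchy filter; the sequence [l] of their limits is the limit in norm because
    the Cauchy estimate holds for each partial sum, where one passes to the
    limit, uniformly in the number of terms. *)
Lemma l2_complete (F : set_system (l2 R)) :
  ProperFilter F -> cauchy F -> cvg F.
Proof.
move=> FF /cauchy_ballP Fc.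
have coord_cvg (f : l2 R -> R) : (forall x y, `|f x - f y| <= `|x - y|) ->
    cvg (f @ F).
  move=> fle; apply: R_complete; apply/cauchy_ballP => e e0.
  have [[A B] /= [FA FB] AB] := Fc e e0.
  exists (f @` A, f @` B) => /=.
    by split; [apply: filterS FA|apply: filterS FB] => x ?; exists x.
  move=> [_ _] /= [[x Ax <-] [y By <-]].
  apply: le_lt_trans (fle x y) _.
  by have := AB (x, y) (conj Ax By); rewrite -ball_normE.
pose l n := (lim ((fun x => (x n).1) @ F), lim ((fun x => (x n).2) @ F)) : R * R.
have cvg1 n : (fun x => (x n).1) @ F --> (l n).1.
  by apply: coord_cvg => x y; have [] := coord_le_norm (x - y) n.
have cvg2 n : (fun x => (x n).2) @ F --> (l n).2.
  by apply: coord_cvg => x y; have [] := coord_le_norm (x - y) n.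
(* the Cauchy estimate after passing to the limit in the second point *)
have close (e : R) : 0 < e -> F [set x : l2 R | forall n,
    \sum_(0 <= i < n) pairdot (x i - l i) (x i - l i) <= e ^+ 2].
  move=> e0; have [[A B] /= [FA FB] AB] := Fc e e0.
  apply: filterS FA => x Ax n.
  have lim_sum :
      (fun y : l2 R => \sum_(0 <= i < n) pairdot (x i - y i) (x i - y i)) @ F -->
      \sum_(0 <= i < n) pairdot (x i - l i) (x i - l i).
    apply: cvg_big => [|i _]; first exact: add_continuous.
    rewrite /pairdot /=.
    by apply: cvgD; apply: cvgM; apply: cvgB => //; exact: cvg_cst.
  rewrite -(cvg_lim _ lim_sum)//; apply: limr_le; first exact: cvgP lim_sum.
  apply: filterS FB => y By; apply: le_trans (pairdot_sum_le (x - y) n) _.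
  rewrite ler_pXn2r ?nnegrE ?(ltW e0)//; apply/ltW.
  by have := AB (x, y) (conj Ax By); rewrite -ball_normE.
(* l is the difference of some x in l2 and of x - l, which is square summable *)
have l_mem : l \in @square_summable R.
  have [x xl] := filter_ex (close 1 ltr01).
  have xlP : (l2val x - l)%R \in @square_summable R.
    by apply/square_summableP; exists (1 ^+ 2) => n; exact: xl.
  rewrite -[l](subKr (l2val x)); apply: rpredB => //; exact: l2valP.
apply/cvg_ex; exists (L2 l_mem); apply/cvgrPdist_le => e e0.
apply: filterS (close e e0) => x xl.
rewrite distrC -(@ler_pXn2r _ 2)// ?nnegrE ?(ltW e0)// l2_normE sqr_l2norm.
apply: limr_le; first exact: is_cvg_l2dot.
by apply: nearW => n; exact: xl.
Qed.

End l2_complete.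

HB.instance Definition _ (R : realType) :=
  Uniform_isComplete.Build (l2 R) (@l2_complete R).

HB.instance Definition _ (R : realType) :=
  CompleteNormedModule_isHilbert.Build R (l2 R)
    (fun x => esym (sqr_l2norm x)).

Lemma l2_innerE (R : realType) (x y : l2 R) : inner x y = l2dot x y.
Proof. by []. Qed.

(** * Monotonicity of linear operators *)

Section inner_product.
Variables (R : realType) (X : hilbertType R).
Implicit Types x y z : X.

Lemma innerC x y : inner x y = inner y x.
Proof. by rewrite hermC expr0 mul1r. Qed.

Lemma innerDl x y z : inner (x + y) z = inner x z + inner y z.
Proof. exact: linearDl. Qed.

Lemma innerDr x y z : inner x (y + z) = inner x y + inner x z.
Proof. by rewrite !(innerC x) innerDl. Qed.

Lemma innerNl x y : inner (- x) y = - inner x y.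
Proof. exact: linearNl. Qed.

Lemma innerNr x y : inner x (- y) = - inner x y.
Proof. by rewrite !(innerC x) innerNl. Qed.

Lemma innerZl k x y : inner (k *: x) y = k * inner x y.
Proof. exact: linearZl_LR. Qed.

Lemma innerZr k x y : inner x (k *: y) = k * inner x y.
Proof. by rewrite !(innerC x) innerZl. Qed.

Lemma inner0l y : inner 0 y = 0 :> R.
Proof. exact: linear0l. Qed.

Lemma inner_ge0 x : 0 <= inner x x.
Proof. by rewrite innerxx exprn_ge0. Qed.

Lemma inner_eq0 x : inner x x = 0 -> x = 0.
Proof. by rewrite innerxx => /eqP; rewrite sqrf_eq0 normr_eq0 => /eqP. Qed.

Definition innerE := (innerDl, innerDr, innerNl, innerNr).

End inner_product.

Section linear_monotone.
Variables (R : realType) (X : hilbertType R) (A : {linear X -> X}).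
Implicit Types x y z : X.

Lemma linear_monotone : (forall x, 0 <= inner x (A x)) -> monotone_op A.
Proof. by move=> A0 x y; rewrite -linearB. Qed.

Lemma linear_paramonotone : monotone_op A ->
  (forall x, inner x (A x) = 0 -> A x = 0) -> paramonotone_op A.
Proof.
move=> mA kerA; split=> // x y; rewrite -linearB => /kerA.
by rewrite linearB => /eqP; rewrite subr_eq0 => /eqP.
Qed.

Lemma linear_strictly_monotone : monotone_op A ->
  (forall x, inner x (A x) = 0 -> x = 0) -> strictly_monotone_op A.
Proof.
move=> mA kerA; split=> // x y; rewrite -linearB => /kerA /eqP.
by rewrite subr_eq0 => /eqP.
Qed.

Lemma paramonotone_ker x : paramonotone_op A -> inner x (A x) = 0 -> A x = 0.
Proof. by move=> [_ /(_ x 0)]; rewrite (linear0 A) !subr0. Qed.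

Lemma strictly_monotone_ker x :
  strictly_monotone_op A -> inner x (A x) = 0 -> x = 0.
Proof. by move=> [_ /(_ x 0)]; rewrite (linear0 A) !subr0. Qed.

Lemma three_star_monotone_opP : three_star_monotone_op A <-> monotone_op A /\
  forall z x, exists M, forall y, inner (z - y) (A y - A x) <= M.
Proof.
split=> -[mA bA]; split=> // z x.
  have := bA z x; set s := ereal_sup _ => s_lty.
  exists (fine s) => y.
  have ys : ((inner (z - y) (A y - A x))%:E <= s)%E.
    by apply: ereal_sup_ubound; exists y.
  rewrite -lee_fin fineK// fin_numE (lt_eqF s_lty) andbT.
  by rewrite gt_eqF// (lt_le_trans _ ys)// ltNyr.
have [M yM] := bA z x; apply: (@le_lt_trans _ _ M%:E); last exact: ltry.
by apply: ge_ereal_sup => _ [y _ <-]; rewrite lee_fin.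
Qed.

Lemma three_star_monotone_bounded z : three_star_monotone_op A ->
  exists M, forall y, inner (z - y) (A y) <= M.
Proof.
rewrite three_star_monotone_opP => -[_ /(_ z 0)[M yM]]; exists M => y.
by have := yM y; rewrite (linear0 A) !subr0.
Qed.

Lemma strictly_monotone_paramonotone :
  strictly_monotone_op A -> paramonotone_op A.
Proof. by move=> [mA sA]; split=> // x y /sA ->. Qed.

(** If [q x = 0], the expression [inner (z - y) (A y)] at [y = t *: x] is
    [t * inner z (A x)], linear in [t]; being bounded above, it vanishes for
    every [z], in particular for [z = A x]. *)
Lemma three_star_monotone_paramonotone :
  three_star_monotone_op A -> paramonotone_op A.
Proof.
move=> tA; apply: linear_paramonotone => [|x x0]; first by case: tA.
apply: inner_eq0; apply/eqP/negPn/negP => Ax0.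
have [M yM] := three_star_monotone_bounded (A x) tA.
have := yM ((M + 1) / inner (A x) (A x) *: x).
rewrite [A (_ *: x)]linearZ /= innerZr innerDl innerNl innerZl x0.
by rewrite mulr0 subr0 divfK// leNgt ltrDl ltr01.
Qed.

(** The cyclic inequality at [y], [z], [x] bounds [inner (z - y) (A y)] by
    [inner (z - x) (A z) + inner (x - y) (A x)]; subtracting
    [inner (z - y) (A x)] makes [y] cancel on the right. *)
Lemma three_cyclic_three_star_monotone :
  monotone_op A -> three_cyclic_monotone_op A -> three_star_monotone_op A.
Proof.
move=> mA cA; apply/three_star_monotone_opP; split=> // z x.
exists (inner (z - x) (A z - A x)) => y.
by have := cA y z x; rewrite !innerE; lra.
Qed.

(** For symmetric [A] the cyclic sum is half of
    [q (x - y) + q (y - z) + q (z - x)]. *)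
Lemma symmetric_three_cyclic_monotone : monotone_op A ->
  (forall x y, inner x (A y) = inner y (A x)) -> three_cyclic_monotone_op A.
Proof.
move=> mA sA x y z; have := mA x y; have := mA y z; have := mA z x.
rewrite !innerE (sA y x) (sA z x) (sA z y); lra.
Qed.

(** With [v = z - x] and [w = y - x], the quantity to bound is
    [inner v (A w) - q w], at most [inner v (A w) - |A w|^2 / C], and completing
    the square gives the bound [C / 4 * |v|^2]. *)
Lemma cocoercive_three_star_monotone (C : R) : monotone_op A -> 0 < C ->
  (forall x, inner (A x) (A x) <= C * inner x (A x)) ->
  three_star_monotone_op A.
Proof.
move=> mA C0 coA; apply/three_star_monotone_opP; split=> // z x.
pose v := z - x; exists (C / 4 * inner v v) => y.
pose w := y - x.
have -> : z - y = v - w by rewrite /v /w opprB addrA subrK.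
rewrite -linearB -/w; move: (v) (w) => {}v {}w.
have := inner_ge0 ((C / 2) *: v - A w).
rewrite !innerE !innerZl !innerZr (innerC (A w) v) => sq.
have coAw := coA w; rewrite -(ler_pM2l C0); lra.
Qed.

Lemma monotonicity_code_eq (p s c t : bool) :
  (if p then paramonotone_op A else ~ paramonotone_op A) ->
  (if s then strictly_monotone_op A else ~ strictly_monotone_op A) ->
  (if c then three_cyclic_monotone_op A else ~ three_cyclic_monotone_op A) ->
  (if t then three_star_monotone_op A else ~ three_star_monotone_op A) ->
  monotonicity_code A = [:: p : nat; s : nat; c : nat; t : nat].
Proof.
have asboolE (b : bool) (P : Prop) : (if b then P else ~ P) -> `[< P >] = b.
  by case: b => [/asboolT|/asboolF].
move=> hp hs hc ht; rewrite /monotonicity_code.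
by rewrite (asboolE p _ hp) (asboolE s _ hs) (asboolE c _ hc) (asboolE t _ ht).
Qed.

End linear_monotone.

(** * Test sequences *)

Section single.
Variable R : realType.
Implicit Types u : R * R.

Definition single n u : nat -> R * R := fun i => if i == n then u else 0.

Lemma single_sum n u (w : nat -> R * R) m :
  \sum_(0 <= i < m) pairdot (single n u i) (w i) =
  if (n < m)%N then pairdot u (w n) else 0.
Proof.
have p0 v : pairdot 0 v = 0 :> R by rewrite /pairdot !mul0r addr0.
elim: m => [|m IH]; first by rewrite big_nil.
rewrite big_nat_recr//= IH /single ltnS.
by case: (ltngtP n m) => [_|_|->]; rewrite ?p0 ?addr0 ?add0r.
Qed.

Lemma single_square_summable n u : single n u \in @square_summable R.
Proof.
apply/square_summableP; exists (pairdot u u) => m; rewrite single_sum.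
by case: ifP => _; [rewrite /single eqxx|exact: pairdot_ge0].
Qed.

Definition single_l2 n u : l2 R := L2 (single_square_summable n u).

Lemma inner_single n u x : inner (single_l2 n u) x = pairdot u (x n).
Proof.
rewrite l2_innerE; apply/cvg_lim => //.
apply: cvg_near_cst; exists n.+1 => // m /= nm.
by rewrite /series /= single_sum nm.
Qed.

End single.

Section decaying_sequences.
Variable R : realType.

Lemma geometric_square_summable :
  (fun n => (0, 2^-1 ^+ n)) \in @square_summable R.
Proof.
apply/square_summableP; exists 2 => n.
(* the partial sums of 4^-i, bounded sharply enough for induction *)
suff : \sum_(0 <= i < n) pairdot (0, 2^-1 ^+ i) (0, 2^-1 ^+ i) <=
       2 - 2 * (2^-1 ^+ n) ^+ 2 :> R.
  by move/le_trans; apply; rewrite gerBl mulr_ge0 ?sqr_ge0.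
elim: n => [|n IH]; first by rewrite big_nil expr0; lra.
rewrite big_nat_recr//= [X in _ + X]/pairdot /= (exprS _ n).
move: IH; move: (\sum_(_ <= _ < _) _) (2^-1 ^+ n) => S q IH.
have := sqr_ge0 q; lra.
Qed.

(** The square of the n-th term of a square summable sequence, divided by
    [n.+1 ^+ 2]: the coefficient at which that sequence refutes 3-star
    monotonicity in [block_op_not_three_star_monotone]. *)
Definition vanishing n : R := (2^-1 ^+ n / n.+1%:R) ^+ 2.

Lemma vanishing_gt0 n : 0 < vanishing n.
Proof. by rewrite exprn_gt0// divr_gt0// exprn_gt0// invr_gt0. Qed.

Lemma vanishing_le1 n : vanishing n <= 1.
Proof.
rewrite exprn_ile1// ?divr_ge0 ?exprn_ge0 ?invr_ge0//.
rewrite ler_pdivrMr// mul1r (@le_trans _ _ 1)// ?ler1n//.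
by rewrite exprn_ile1 ?invr_ge0// invf_le1// ler1n.
Qed.

End decaying_sequences.

(** * Block diagonal operators *)

Section block_operator.
Variable R : realType.
Implicit Types x y z : l2 R.

(** Multiplication by the complex number k + i l. *)
Definition block (k l : R) (u : R * R) : R * R :=
  (k * u.1 - l * u.2, l * u.1 + k * u.2).

Lemma pairdot_block k l u : pairdot u (block k l u) = k * pairdot u u.
Proof. by rewrite /pairdot /=; ring. Qed.

Lemma pairdot_blockblock k l u :
  pairdot (block k l u) (block k l u) = (k ^+ 2 + l ^+ 2) * pairdot u u.
Proof. by rewrite /pairdot /=; ring. Qed.

Definition bounded_blocks (a b : nat -> R) :=
  exists K, forall n, a n ^+ 2 + b n ^+ 2 <= K.

Variables (a b : nat -> R) (ab : bounded_blocks a b).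

Lemma block_square_summable x :
  (fun n => block (a n) (b n) (x n)) \in @square_summable R.
Proof.
have [K abK] := ab; have /square_summableP[M xM] := l2valP x.
have K0 : 0 <= K by apply: le_trans (abK 0); rewrite addr_ge0 ?sqr_ge0.
apply/square_summableP; exists (K * M) => n.
apply: le_trans (ler_wpM2l K0 (xM n)); rewrite mulr_sumr; apply: ler_sum => i _.
by rewrite pairdot_blockblock ler_wpM2r ?pairdot_ge0.
Qed.

Definition block_fun x : l2 R := L2 (block_square_summable x).

Let block_fun_linear : linear block_fun.
Proof.
move=> k x y; apply: l2P => n.
have scaleE (r : R) : k *: r = k * r by [].
by congr pair; rewrite /= !scaleE; ring.
Qed.

HB.instance Definition _ :=
  GRing.isLinear.Build R (l2 R) (l2 R) *:%R block_fun block_fun_linear.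

Definition block_op : {linear l2 R -> l2 R} := block_fun.

Lemma block_op_single n u :
  block_op (single_l2 n u) = single_l2 n (block (a n) (b n) u).
Proof.
apply: l2P => i; rewrite /= /single; case: eqVneq => [->//|_].
by rewrite /block /= !mulr0 subr0 addr0.
Qed.

Hypothesis a_ge0 : forall n, 0 <= a n.

Lemma pairdot_block_op_ge0 x n : 0 <= pairdot (x n) (block_op x n).
Proof. by rewrite pairdot_block mulr_ge0 ?pairdot_ge0. Qed.

Lemma block_op_monotone : monotone_op block_op.
Proof.
apply: linear_monotone => x; rewrite l2_innerE; apply: l2dot_ge0.
exact: pairdot_block_op_ge0.
Qed.

Lemma block_op_inner_eq0 x : inner x (block_op x) = 0 ->
  forall n, a n = 0 \/ x n = 0.
Proof.
move=> /(l2dot_eq0 (pairdot_block_op_ge0 x)) x0 n.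
have /eqP := x0 n; rewrite pairdot_block mulf_eq0.
by case/orP => /eqP; [left|right; exact: pairdot_eq0].
Qed.

Lemma block_op_paramonotone : (forall n, a n = 0 -> b n = 0) ->
  paramonotone_op block_op.
Proof.
move=> ab0; apply: linear_paramonotone block_op_monotone _.
move=> x /block_op_inner_eq0 x0.
apply: l2P => n /=; have [an0|->] := x0 n.
  by rewrite an0 ab0// /block !mul0r subr0 addr0.
by rewrite /block /= !mulr0 subr0 addr0.
Qed.

Lemma block_op_not_paramonotone n : a n = 0 -> b n != 0 ->
  ~ paramonotone_op block_op.
Proof.
move=> an0 bn0 /paramonotone_ker => /(_ (single_l2 n (1, 0))).
rewrite block_op_single inner_single /= /single eqxx an0.
have -> : pairdot (1, 0) (block 0 (b n) (1, 0)) = 0 by rewrite /pairdot /=; ring.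
move=> /(_ erefl)/(congr1 (fun x : l2 R => (x n).2)) /=.
by rewrite /single eqxx /= mul0r addr0 mulr1 => /eqP; exact/negP.
Qed.

Lemma block_op_strictly_monotone : (forall n, a n != 0) ->
  strictly_monotone_op block_op.
Proof.
move=> an0; apply: linear_strictly_monotone block_op_monotone _.
move=> x /block_op_inner_eq0 x0; apply: l2P => n.
by have [/eqP|//] := x0 n; rewrite (negPf (an0 n)).
Qed.

Lemma block_op_not_strictly_monotone n : a n = 0 ->
  ~ strictly_monotone_op block_op.
Proof.
move=> an0 /strictly_monotone_ker => /(_ (single_l2 n (1, 0))).
rewrite block_op_single inner_single /= /single eqxx an0.
have -> : pairdot (1, 0) (block 0 (b n) (1, 0)) = 0 by rewrite /pairdot /=; ring.
move=> /(_ erefl)/(congr1 (fun x : l2 R => (x n).1)) /=.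
by rewrite /single eqxx /= => /eqP; rewrite oner_eq0.
Qed.

Lemma block_op_three_cyclic_monotone : (forall n, b n = 0) ->
  three_cyclic_monotone_op block_op.
Proof.
move=> b0; apply: symmetric_three_cyclic_monotone block_op_monotone _ => x y.
congr (limn (series _)); apply/funext => n.
by rewrite /= /block b0 /pairdot /=; ring.
Qed.

(** At 0 and the two basis vectors of the n-th plane, the cyclic sum is
    [2 * a n - b n]. *)
Lemma block_op_not_three_cyclic_monotone n : 2 * a n < b n ->
  ~ three_cyclic_monotone_op block_op.
Proof.
move=> abn /(_ 0 (single_l2 n (1, 0)) (single_l2 n (0, 1))).
rewrite (linear0 block_op) !block_op_single !innerE !inner_single !inner0l.
rewrite /= /single eqxx.
rewrite /pairdot /=; lra.
Qed.

Lemma block_op_three_star_monotone C : 0 < C ->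
  (forall n, a n ^+ 2 + b n ^+ 2 <= C * a n) -> three_star_monotone_op block_op.
Proof.
move=> C0 abC; apply: (cocoercive_three_star_monotone block_op_monotone C0) => x.
rewrite -innerZl; apply: le_l2dot => n.
have -> : (C *: x) n = C *: x n by [].
rewrite -[C *: x n]addr0 pairdotPl {3}/pairdot !mul0r !addr0.
by rewrite pairdot_blockblock pairdot_block mulrA ler_wpM2r ?pairdot_ge0.
Qed.

(** Take [z n = (0, 2 ^- n)] and let [y] be [(t, 0)] in the n-th plane.  Then
    [inner (z - y) (A y) = t * 2 ^- n - t ^+ 2 * a n], and
    [t = 2 ^+ n * n.+1] makes it [n.+1 - 1], which is unbounded in [n].  The
    hypothesis leaves the plane of index 0 free, so that it can carry a zero
    block. *)
Lemma block_op_not_three_star_monotone :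
  (forall n, (0 < n)%N -> a n = vanishing R n /\ b n = 1) ->
  ~ three_star_monotone_op block_op.
Proof.
move=> abn /(three_star_monotone_bounded (L2 (geometric_square_summable R)))[M yM].
pose n := (Num.bound `|M|).+1.
pose t : R := 2 ^+ n * n.+1%:R.
have := yM (single_l2 n (t, 0)); rewrite block_op_single innerC.
rewrite inner_single l2Bl /= /single eqxx.
have [-> ->] := abn n isT.
have -> : pairdot (block (vanishing R n) 1 (t, 0))
                  ((0, 2^-1 ^+ n) - (t, 0)) = n%:R.
  have e0 : 2 ^+ n != 0 :> R by rewrite expf_neq0.
  have n0 : n%:R + 1 != 0 :> R by rewrite natr1.
  rewrite /pairdot /vanishing /= /t exprVn -natr1; field.
  by rewrite e0 addrC n0.
rewrite leNgt => /negP; apply.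
apply: le_lt_trans (ler_norm M) _; apply: lt_le_trans (archi_boundP _) _ => //.
by rewrite ler_nat.
Qed.

End block_operator.

(** * The seven codes *)

Section codes.
Variable R : realType.

Definition codes : set (seq nat) :=
  [set w : seq nat | exists (X : hilbertType R) (A : {linear X -> X}),
     monotone_op A /\ monotonicity_code A = w].

Lemma codes_sub w : codes w ->
  w \in [:: [:: 0; 0; 0; 0]; [:: 1; 0; 0; 0]; [:: 1; 0; 0; 1];
    [:: 1; 0; 1; 1]; [:: 1; 1; 0; 0]; [:: 1; 1; 0; 1]; [:: 1; 1; 1; 1]]%N.
Proof.
move=> [X [A [mA <-]]]; rewrite /monotonicity_code.
have sp : `[< strictly_monotone_op A >] ==> `[< paramonotone_op A >].
  apply/implyP => /asboolP sA; apply/asboolP.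
  exact: strictly_monotone_paramonotone.
have tp : `[< three_star_monotone_op A >] ==> `[< paramonotone_op A >].
  apply/implyP => /asboolP tA; apply/asboolP.
  exact: three_star_monotone_paramonotone.
have ct : `[< three_cyclic_monotone_op A >] ==> `[< three_star_monotone_op A >].
  apply/implyP => /asboolP cA; apply/asboolP.
  exact: three_cyclic_three_star_monotone.
by move: sp tp ct; do 4 case: asbool.
Qed.

Lemma block_op_code (a b : nat -> R) (K : R) (p s c t : bool) :
  (forall n, a n ^+ 2 + b n ^+ 2 <= K) -> (forall n, 0 <= a n) ->
  (forall ab : bounded_blocks a b,
    [/\ if p then paramonotone_op (block_op ab)
     else ~ paramonotone_op (block_op ab),
     if s then strictly_monotone_op (block_op ab)
     else ~ strictly_monotone_op (block_op ab),
     if c then three_cyclic_monotone_op (block_op ab)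
     else ~ three_cyclic_monotone_op (block_op ab) &
     if t then three_star_monotone_op (block_op ab)
     else ~ three_star_monotone_op (block_op ab)]) ->
  codes [:: p : nat; s : nat; c : nat; t : nat].
Proof.
move=> abK a0 pst; have ab : bounded_blocks a b by exists K.
exists (l2 R), (block_op ab); split; first exact: block_op_monotone.
by have [] := pst ab; exact: monotonicity_code_eq.
Qed.

(** Quarter turn of every plane. *)
Lemma code0000 : codes [:: 0; 0; 0; 0]%N.
Proof.
apply: (@block_op_code (fun=> 0) (fun=> 1) 1 false false false false) => [n|//|ab].
  by rewrite expr0n expr1n add0r.
have np : ~ paramonotone_op (block_op ab).
  exact: (@block_op_not_paramonotone _ _ _ ab 0 _ (oner_neq0 R)).
split=> //.
- by move/strictly_monotone_paramonotone.
- by apply: (@block_op_not_three_cyclic_monotone _ _ _ ab 0); lra.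
- by move/three_star_monotone_paramonotone.
Qed.

(** The operator of [code1100] with its first block replaced by 0. *)
Lemma code1000 : codes [:: 1; 0; 0; 0]%N.
Proof.
pose a n : R := if n is 0 then 0 else vanishing R n.
pose b n : R := if n is 0 then 0 else 1.
have a0 n : 0 <= a n by case: n => // n; exact/ltW/vanishing_gt0.
have an1 n : a n <= 1 by case: n => // n; exact: vanishing_le1.
have bn1 n : b n ^+ 2 <= 1.
  by case: n => [|n]; rewrite /b ?expr1n// expr0n.
apply: (@block_op_code a b 2 true false false false) => // [n|ab].
  by have := a0 n; have := an1 n; have := bn1 n; nra.
have nt : ~ three_star_monotone_op (block_op ab).
  by apply: block_op_not_three_star_monotone => -[].
split=> //.
- apply: block_op_paramonotone => // -[//|n] an0.
  by have := vanishing_gt0 R n.+1; rewrite -[vanishing _ _]/(a n.+1) an0 ltxx.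
- exact: (@block_op_not_strictly_monotone _ _ _ ab 0).
- by move/(three_cyclic_three_star_monotone (block_op_monotone ab a0)).
Qed.

(** The operator of [code1101] with its first block replaced by 0. *)
Lemma code1001 : codes [:: 1; 0; 0; 1]%N.
Proof.
pose a n : R := if n is 0 then 0 else 1.
pose b n : R := if n is 0 then 0 else 3.
have a0 n : 0 <= a n by case: n.
apply: (@block_op_code a b 10 true false false true) => // [[|n]|ab]; rewrite /=.
- by lra.
- by lra.
have t3 : three_star_monotone_op (block_op ab).
  by apply: (@block_op_three_star_monotone _ _ _ _ _ 10) => // -[|n] /=; lra.
split=> //.
- exact: three_star_monotone_paramonotone.
- exact: (@block_op_not_strictly_monotone _ _ _ ab 0).
- by apply: (@block_op_not_three_cyclic_monotone _ _ _ ab 1) => /=; lra.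
Qed.

(** Zero operator. *)
Lemma code1011 : codes [:: 1; 0; 1; 1]%N.
Proof.
apply: (@block_op_code (fun=> 0) (fun=> 0) 0 true false true true) => // [n|ab].
  by rewrite expr0n addr0.
have c3 : three_cyclic_monotone_op (block_op ab).
  exact: block_op_three_cyclic_monotone.
have t3 := three_cyclic_three_star_monotone (block_op_monotone ab (fun=> lexx 0)) c3.
split=> //.
- exact: three_star_monotone_paramonotone.
- exact: (@block_op_not_strictly_monotone _ _ _ ab 0).
Qed.

(** Quarter turn plus a positive diagonal part that tends to 0. *)
Lemma code1100 : codes [:: 1; 1; 0; 0]%N.
Proof.
have a0 n : 0 <= vanishing R n by exact/ltW/vanishing_gt0.
apply: (@block_op_code (vanishing R) (fun=> 1) 2 true true false false) => // [n|ab].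
  have := a0 n; have := @vanishing_le1 R n; nra.
have st : strictly_monotone_op (block_op ab).
  by apply: block_op_strictly_monotone => // n; rewrite gt_eqF// vanishing_gt0.
have nt : ~ three_star_monotone_op (block_op ab).
  exact: block_op_not_three_star_monotone.
split=> //.
- exact: strictly_monotone_paramonotone.
- by move/(three_cyclic_three_star_monotone (block_op_monotone ab a0)).
Qed.

(** Identity plus three times the quarter turn, a multiple large enough for
    [block_op_not_three_cyclic_monotone]. *)
Lemma code1101 : codes [:: 1; 1; 0; 1]%N.
Proof.
apply: (@block_op_code (fun=> 1) (fun=> 3) 10 true true false true) => // [n|ab].
  by lra.
have st : strictly_monotone_op (block_op ab).
  by apply: block_op_strictly_monotone => // n; exact: oner_neq0.
split=> //.
- exact: strictly_monotone_paramonotone.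
- by apply: (@block_op_not_three_cyclic_monotone _ _ _ ab 0) => /=; lra.
- by apply: (@block_op_three_star_monotone _ _ _ _ _ 10) => // n /=; lra.
Qed.

(** Identity. *)
Lemma code1111 : codes [:: 1; 1; 1; 1]%N.
Proof.
apply: (@block_op_code (fun=> 1) (fun=> 0) 1 true true true true) => // [n|ab].
  by lra.
have st : strictly_monotone_op (block_op ab).
  by apply: block_op_strictly_monotone => // n; exact: oner_neq0.
have c3 : three_cyclic_monotone_op (block_op ab).
  exact: block_op_three_cyclic_monotone.
split=> //.
- exact: strictly_monotone_paramonotone.
- exact: three_cyclic_three_star_monotone (block_op_monotone ab (fun=> ler01)) c3.
Qed.

End codes.

Theorem mainTheorem2 (R : realType) :
  [set w : seq nat | exists (X : hilbertType R) (A : {linear X -> X}),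
     monotone_op A /\ monotonicity_code A = w] =
  [set [:: 0; 0; 0; 0]%N; [:: 1; 0; 0; 0]%N; [:: 1; 0; 0; 1]%N;
       [:: 1; 0; 1; 1]%N; [:: 1; 1; 0; 0]%N; [:: 1; 1; 0; 1]%N;
       [:: 1; 1; 1; 1]%N].
Proof.
apply/seteqP; split=> [w /codes_sub|w].
  rewrite !inE => /or4P[/eqP->|/eqP->|/eqP->|/or4P[] /eqP->];
    rewrite /=; tauto.
rewrite /= => -[[[[[[|]|]|]|]|]|] ->;
  [exact: code0000|exact: code1000|exact: code1001|exact: code1011|
   exact: code1100|exact: code1101|exact: code1111].
Qed.
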